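(* For every integer $k \geq 2$ and every function $f : \mathbb{N} \to \mathbb{R}$ there exists an integer $n_0$ such that for every odd integer $n \geq n_0$ there exists an $n$-vertex Hamiltonian graph $G$ satisfying $\alpha(G) = k$, $n \geq f(k)$, and $\mathcal{C}_n(G) \neq \mathcal{C}(G)$.
   Context: Graphs are finite and simple. $\alpha(G)$ is the independence number of $G$. The cycle space $\mathcal{C}(G)$ is the vector space over $\mathbb{F}_2$ spanned by the incidence vectors (in $\mathbb{F}_2^{E(G)}$) of the edge-sets of all cycles of $G$. If $G$ has $n$ vertices, $\mathcal{C}_n(G)$ is the subspace of $\mathcal{C}(G)$ spanned by the incidence vectors of the edge-sets of cycles of length $n$ in $G$, i.e. of Hamilton cycles of $G$. *)

(* Defs.v *)
From HB Require Import structures.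
From mathcomp Require Import all_boot all_order all_algebra.
From mathcomp Require Import reals.

Set Implicit Arguments.
Unset Strict Implicit.
Unset Printing Implicit Defensive.

Record sgraph := SGraph {
  vertex :> finType;
  adj : rel vertex;
  adj_sym : symmetric adj;
  adj_irrefl : irreflexive adj
}.

Arguments adj {s}.

Section GraphDefs.
Variable G : sgraph.

Definition edges : {set {set G}} :=
  [set d : {set G} | [exists x, exists y, adj x y && (d == [set x; y])]].

Definition edge : finType := {d : {set G} | d \in edges}.

Definition independent (A : {set G}) : bool :=
  [forall x in A, forall y in A, ~~ adj x y].

Definition independence_number : nat :=
  \max_(A : {set G} | independent A) #|A|.

(* A cycle is given by the cyclic sequence of its distinct vertices. The bound
   on the size is needed since [ucycleb] accepts sequences of size 0 and 2. *)
Definition is_cycle (p : seq G) : bool := (2 < size p) && ucycleb adj p.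

Definition cycle_edges (p : seq G) : {set {set G}} :=
  [set [set x; next p x] | x in p].

Definition hamiltonian : Prop :=
  exists p : seq G, is_cycle p /\ size p = #|G|.

(* F_2^E(G); the regular module ('F_2)^o makes this a vector space over 'F_2. *)
Definition edge_space : vectType 'F_2 := {ffun edge -> ('F_2)^o}.

Definition incidence_vector (D : {set {set G}}) : edge_space :=
  [ffun d : edge => ((val d \in D)%:R)%R].

Definition cycle_edge_sets_of_length (m : nat) : {set {set {set G}}} :=
  [set cycle_edges p | p : m.-tuple G & is_cycle p].

(* The vertices of a cycle are distinct, so its length is at most #|G|. *)
Definition cycle_edge_sets : {set {set {set G}}} :=
  \bigcup_(m < #|G|.+1) cycle_edge_sets_of_length m.

Definition cycle_space : {vspace edge_space} :=
  <<[seq incidence_vector D | D in cycle_edge_sets]>>%VS.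

Definition cycle_space_of_length (m : nat) : {vspace edge_space} :=
  <<[seq incidence_vector D | D in cycle_edge_sets_of_length m]>>%VS.

End GraphDefs.

(* Main.v *)
Require Import Defs.
From HB Require Import structures.
From mathcomp Require Import all_boot all_order all_algebra.
From mathcomp Require Import reals.
From mathcomp Require Import zify.

(** Take a graph on the vertices 0, ..., n-1 in which the vertex 0 has only the
    two neighbours 1 and n-1. Every Hamilton cycle must
    enter and leave 0, so it uses the edge {0, 1}; and it has n edges, an odd
    number. Hence the linear functional on the edge space that sends v to the
    sum of all coordinates of v plus the coordinate of v at {0, 1} vanishes on
    every Hamilton cycle, and so on the space that they span
    ([hamilton_cycle_in_kernel]). On a triangle that avoids 0 the functional is
    3 + 0 = 1, so this triangle lies outside that space
    ([cycle_space_neq_of_degree_two]).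

    The rest of the graph is chosen to have independence number k and yet many
    edges: the even vertices 0, 2, ..., 2k-2 are independent, all other pairs
    are adjacent except those excluded by the choice of the neighbours of 0.
    Then 0, 1, ..., n-1 is a Hamilton cycle as soon as 2k < n, and 1, 2, 3 is a
    triangle that avoids 0. *)

Set Implicit Arguments.
Unset Strict Implicit.
Unset Printing Implicit Defensive.

Import Order.TTheory GRing.Theory Num.Theory.

(** * Edges of a cycle *)

Lemma next_next_neq (T : eqType) (p : seq T) (x : T) :
  uniq p -> 2 < size p -> x \in p -> next p (next p x) != x.
Proof.
move=> up sp /rot_to[i q rq].
have uq : uniq (x :: q) by rewrite -rq rot_uniq.
have sq : 2 < size (x :: q) by rewrite -rq size_rot.
rewrite -!(next_rot i up) rq.
case: q uq sq {rq} => [|y [|z q]] //= /andP[]; rewrite !inE !negb_or.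
case/and3P=> xy xz _ _ _.
by rewrite !eqxx (eq_sym y) (negPf xy) eq_sym.
Qed.

Lemma set2_eq (T : finType) (x y u v : T) :
  [set x; y] = [set u; v] -> x != u -> x = v /\ y = u.
Proof.
move=> E xu.
have: x \in [set u; v] by rewrite -E set21.
rewrite !inE (negPf xu) /= => /eqP xv; split=> //.
have: u \in [set x; y] by rewrite E set21.
by rewrite !inE eq_sym (negPf xu) /= => /eqP.
Qed.

Section CycleEdges.
Variable G : sgraph.

Lemma is_cycle_uniq (p : seq G) : is_cycle p -> uniq p.
Proof. by case/andP=> _ /andP[]. Qed.

Lemma is_cycle_size (p : seq G) : is_cycle p -> 2 < size p.
Proof. by case/andP. Qed.

Lemma is_cycle_next (p : seq G) x : is_cycle p -> x \in p -> adj x (next p x).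
Proof. by case/andP=> _ /andP[cp _]; apply: next_cycle. Qed.

(** Two vertices of p can give the same edge only if each is the successor of
    the other, and then the cycle would have length 2. *)
Lemma card_cycle_edges (p : seq G) : is_cycle p -> #|cycle_edges p| = size p.
Proof.
move=> cp; have up := is_cycle_uniq cp.
rewrite card_in_imset; first exact/card_uniqP.
move=> x y xp yp /= E; apply/eqP; apply: contraT => xy.
have [xE yE] := set2_eq E xy.
by have := next_next_neq up (is_cycle_size cp) xp; rewrite yE -xE eqxx.
Qed.

Lemma cycle_edges_sub (p : seq G) : is_cycle p -> cycle_edges p \subset edges G.
Proof.
move=> cp; apply/subsetP => d /imsetP[x xp ->]; rewrite inE.
apply/existsP; exists x; apply/existsP; exists (next p x).
by rewrite is_cycle_next // eqxx.
Qed.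

Lemma edge_in_edges (x y : G) : adj x y -> [set x; y] \in edges G.
Proof.
by move=> xy; rewrite inE; apply/existsP; exists x; apply/existsP; exists y;
   rewrite xy eqxx.
Qed.

Definition edge_of (x y : G) (xy : adj x y) : edge G :=
  exist _ [set x; y] (edge_in_edges xy).

(** The predecessor and the successor of v on p are distinct neighbours of v,
    so both a and b occur next to v. *)
Lemma degree_two_edge_in_cycle (p : seq G) (v a b : G) :
  (forall w, adj v w -> (w == a) || (w == b)) ->
  is_cycle p -> v \in p -> [set v; a] \in cycle_edges p.
Proof.
move=> nv cp vp; have up := is_cycle_uniq cp.
have up' : prev p v \in p by rewrite mem_prev.
have nuv : next p (prev p v) = v by apply: next_prev.
have vw := is_cycle_next cp vp.
have vu : adj v (prev p v).
  by have := is_cycle_next cp up'; rewrite nuv adj_sym.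
have neq : next p v != prev p v.
  by have := next_next_neq up (is_cycle_size cp) up'; rewrite nuv.
have [E|wa] := eqVneq (next p v) a; first by rewrite -E; apply: imset_f.
have [E|ua] := eqVneq (prev p v) a.
  by apply/imsetP; exists (prev p v); rewrite // nuv E setUC.
have /orP[/eqP E|/eqP wb] := nv _ vw; first by rewrite E eqxx in wa.
have /orP[/eqP E|/eqP ub] := nv _ vu; first by rewrite E eqxx in ua.
by rewrite wb ub eqxx in neq.
Qed.

Lemma cycle_edge_incident (p : seq G) (v a : G) :
  is_cycle p -> [set v; a] \in cycle_edges p -> v \in p.
Proof.
move=> cp /imsetP[x xp E].
have: v \in [set x; next p x] by rewrite -E set21.
by rewrite !inE => /orP[] /eqP->; rewrite ?mem_next.
Qed.

(** * The parity functional *)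

Local Open Scope ring_scope.

(** On the incidence vector of an edge set D this is the parity of #|D| plus
    the indicator of e in D. A sum over all edges detects odd length; the extra
    coordinate cancels it on the odd cycles through e. *)
Definition parity_with (e : edge G) (x : edge_space G) : ('F_2)^o :=
  \sum_d x d + x e.

Lemma parity_with_linear (e : edge G) : linear (parity_with e).
Proof.
move=> c x y; rewrite /parity_with !ffunE.
under eq_bigr do rewrite !ffunE.
by rewrite big_split /= -scaler_sumr scalerDr addrACA.
Qed.

HB.instance Definition _ (e : edge G) :=
  GRing.isLinear.Build _ _ _ _ (parity_with e) (parity_with_linear e).

Lemma parity_with_incidence (e : edge G) (D : {set {set G}}) :
  D \subset edges G ->
  parity_with e (incidence_vector D) = (#|D| + (val e \in D))%:R :> 'F_2.
Proof.
move=> /subsetP sD; rewrite /parity_with natrD ffunE; congr (_ + _).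
under eq_bigr do rewrite ffunE.
rewrite -natr_sum; congr _%:R.
rewrite -(big_mkcond (fun d : edge G => val d \in D) (fun=> 1%N)) sum1_card.
rewrite -(card_imset _ val_inj); apply: eq_card => d.
apply/imsetP/idP => [[u uD ->] //|dD].
by exists (exist _ d (sD _ dD)).
Qed.

Lemma natrF2 (m : nat) : m%:R = (odd m)%:R :> 'F_2.
Proof.
by apply: val_inj; rewrite /= !val_Fp_nat // !modn2; case: (odd m).
Qed.

(** A Hamilton cycle through the degree-two vertex v has an odd number of edges
    and contains the edge from v to a, so the two terms of the functional cancel. *)
Lemma hamilton_cycle_in_kernel (v a b : G) (va : adj v a) :
  (forall w, adj v w -> (w == a) || (w == b)) -> odd #|G| ->
  (cycle_space_of_length G #|G|
     <= lker (linfun (parity_with (edge_of va))))%VS.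
Proof.
move=> nv oG; apply/span_subvP => _ /imageP[D /imsetP[p cp ->] ->].
rewrite inE in cp; rewrite memv_ker lfunE /= parity_with_incidence; last first.
  exact: cycle_edges_sub.
have vp : v \in (p : seq G).
  have pG : #|(p : seq G)| = #|G|.
    by rewrite (card_uniqP (is_cycle_uniq cp)) size_tuple.
  by rewrite (subset_cardP pG (subset_predT _)).
rewrite /= (degree_two_edge_in_cycle nv cp vp) card_cycle_edges //.
by rewrite size_tuple natrF2 oddD oG.
Qed.

Lemma incidence_in_cycle_space (p : seq G) :
  is_cycle p -> incidence_vector (cycle_edges p) \in cycle_space G.
Proof.
move=> cp; apply: memv_span; apply: image_f.
have sp : (size p < #|G|.+1)%N.
  by rewrite ltnS -(card_uniqP (is_cycle_uniq cp)) max_card.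
apply/bigcupP; exists (Ordinal sp) => //.
by apply/imsetP; exists (in_tuple p); rewrite ?inE.
Qed.

(** On an odd cycle that avoids v, only the first term of the functional
    survives, and it is 1. *)
Lemma cycle_space_neq_of_degree_two (v a b : G) (p : seq G) :
  adj v a -> (forall w, adj v w -> (w == a) || (w == b)) -> odd #|G| ->
  is_cycle p -> odd (size p) -> v \notin p ->
  cycle_space_of_length G #|G| <> cycle_space G.
Proof.
move=> va nv oG cp op vp E.
have := incidence_in_cycle_space cp.
rewrite -E => /(subvP (hamilton_cycle_in_kernel va nv oG)).
rewrite memv_ker lfunE /= parity_with_incidence ?cycle_edges_sub //=.
rewrite (contraNF (cycle_edge_incident cp) vp) card_cycle_edges //.
by rewrite addn0 natrF2 op.
Qed.

End CycleEdges.

(** * The graph *)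

Section Construction.
Variables (k n : nat).
Hypotheses (hk : 2 <= k) (hn : 2 * k < n).

Definition sparse (i : nat) : bool := ~~ odd i && (i < 2 * k).

Definition zero_adj_ok (i j : nat) : bool :=
  (i == 0) ==> ((j == 1) || (j == n.-1)).

(** A relation on natural numbers rather than on ordinals, so that the Hamilton
    cycle becomes a statement about [iota]. *)
Definition cosparse_rel (i j : nat) : bool :=
  [&& i != j, ~~ (sparse i && sparse j), zero_adj_ok i j & zero_adj_ok j i].

Definition cosparse_adj : rel 'I_n := relpre val cosparse_rel.

Lemma cosparse_adj_sym : symmetric cosparse_adj.
Proof.
move=> i j; rewrite /cosparse_adj /= /cosparse_rel eq_sym.
by rewrite (andbC (sparse _)) (andbC (zero_adj_ok _ _)).
Qed.

Lemma cosparse_adj_irrefl : irreflexive cosparse_adj.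
Proof. by move=> i; rewrite /cosparse_adj /= /cosparse_rel eqxx. Qed.

Definition cosparse_graph : sgraph :=
  SGraph cosparse_adj_sym cosparse_adj_irrefl.

Lemma cosparse_adjE (i j : cosparse_graph) :
  adj i j = cosparse_rel (nat_of_ord i) (nat_of_ord j).
Proof. by []. Qed.

(** The bound 2k < n keeps n-1 outside the independent set, which contains 0,
    so the cycle can be closed. *)
Lemma cosparse_hamiltonian : hamiltonian cosparse_graph.
Proof.
exists (enum 'I_n); split; last by rewrite cardE.
apply/andP; split; first by rewrite size_enum_ord; lia.
rewrite /ucycleb enum_uniq andbT -[cycle _ _]/(cycle (relpre val cosparse_rel) _).
rewrite -cycle_map val_enum_ord.
have -> : iota 0 n = 0 :: iota 1 n.-1 by rewrite -{1}(ltn_predK hn).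
rewrite /= rcons_path; apply/andP; split.
  apply/(pathP 0) => i; rewrite size_iota => im.
  rewrite -[0 :: _]/(iota 0 n.-1.+1) !nth_iota ?(leqW im) //.
  rewrite /cosparse_rel /sparse /zero_adj_ok; lia.
rewrite (last_nth 0) size_iota -[_ :: _]/(iota 0 n.-1.+1) nth_iota //.
rewrite /cosparse_rel /sparse /zero_adj_ok; lia.
Qed.

(** An independent set inside the sparse vertices has at most k elements; one
    that contains another vertex c is contained in {c, 0}, and 2 <= k. *)
Lemma cosparse_independence_number : independence_number cosparse_graph = k.
Proof.
apply/eqP; rewrite eqn_leq; apply/andP; split.
  apply/bigmax_leqP => A /forall_inP indA.
  have nadj x y : x \in A -> y \in A -> ~~ adj x y.
    by move=> xA; move/(_ x xA)/forall_inP: indA; apply.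
  have [/subsetP sA|] := boolP (A \subset [set x : cosparse_graph | sparse (nat_of_ord x)]).
    have dbl (x : cosparse_graph) : x \in A -> (nat_of_ord x)./2 < k.
      by move/sA; rewrite inE /sparse; lia.
    pose half (x : cosparse_graph) : 'I_k := insubd (Ordinal (ltnW hk)) (nat_of_ord x)./2.
    have inj : {in A &, injective half}.
      move=> x y xA yA /(congr1 val); rewrite !val_insubd !dbl // => E.
      apply: ord_inj; have := sA x xA; have := sA y yA; move: E.
      rewrite !inE /sparse; lia.
    by rewrite -(card_in_imset inj) -[leqRHS]card_ord max_card.
  case/subsetPn => c cA; rewrite inE => cS.
  have z0 : 0 < n by lia.
  (* every vertex other than 0 and c is adjacent to c *)
  have sub : A \subset [set c; Ordinal z0 : cosparse_graph].
    apply/subsetP => x xA; rewrite !inE -!val_eqE /=.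
    have := nadj x c xA cA; rewrite cosparse_adjE /cosparse_rel /zero_adj_ok.
    rewrite (negPf cS) andbF /=; move: cS; rewrite /sparse; lia.
  apply: leq_trans (subset_leq_card sub) _.
  by apply: leq_trans hk; rewrite cards2; case: (_ != _).
have lt2 (i : 'I_k) : 2 * i < n by have := ltn_ord i; lia.
pose double (i : 'I_k) : cosparse_graph := Ordinal (lt2 i).
have inj : injective double.
  by move=> i j /(congr1 val) /= E; apply: val_inj => /=; lia.
have <- : #|double @: 'I_k| = k by rewrite card_imset // card_ord.
apply: (@leq_bigmax_cond _ (@independent cosparse_graph) (fun A => #|A|)).
apply/forall_inP => _ /imsetP[i _ ->]; apply/forall_inP => _ /imsetP[j _ ->].
rewrite cosparse_adjE /cosparse_rel /sparse /=.
have := ltn_ord i; have := ltn_ord j; lia.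
Qed.

Lemma cosparse_cycle_space_neq :
  odd n -> cycle_space_of_length cosparse_graph n <> cycle_space cosparse_graph.
Proof.
move=> on.
have [l0 l1 l2] : [/\ 0 < n, 1 < n & 2 < n] by split; lia.
have [l3 l4] : 3 < n /\ n.-1 < n by split; lia.
have cG : #|cosparse_graph| = n by rewrite card_ord.
rewrite -{1}cG.
apply: (@cycle_space_neq_of_degree_two cosparse_graph (Ordinal l0) (Ordinal l1)
  (Ordinal l4) [:: Ordinal l1; Ordinal l2; Ordinal l3 : cosparse_graph]) => //.
- rewrite cosparse_adjE /cosparse_rel /sparse /zero_adj_ok /=; lia.
- move=> w; rewrite cosparse_adjE /cosparse_rel /zero_adj_ok -!val_eqE /=; lia.
- by rewrite cG.
- rewrite /is_cycle /ucycleb /= /cosparse_adj /= /cosparse_rel /sparse /zero_adj_ok.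
  lia.
Qed.

End Construction.

Theorem proposition1p14 (R : realType) (k : nat) (hk : 2 <= k)
    (f : nat -> R) :
  exists n0 : nat, forall n : nat, odd n -> n0 <= n ->
    exists G : sgraph,
      [/\ #|G| = n,
          hamiltonian G,
          independence_number G = k,
          (f k <= n%:R)%R
        & cycle_space_of_length G n <> cycle_space G].
Proof.
exists (maxn (2 * k).+1 (Num.bound `|f k|%R)) => n on.
rewrite geq_max => /andP[hn fn]; exists (cosparse_graph k n); split.
- by rewrite card_ord.
- exact: cosparse_hamiltonian.
- exact: cosparse_independence_number.
- apply: le_trans (ler_norm _) _.
  by apply: le_trans (ltW (archi_boundP (normr_ge0 _))) _; rewrite ler_nat.
- exact: cosparse_cycle_space_neq.
Qed.
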